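(* Let $X$ be a normed linear space with closed unit ball $B_X$ (regarded as a metric space with the metric inherited from $X$). If $\operatorname{rpc} B_X\le\alpha$, where $\alpha$ is an infinite regular cardinal, then $\operatorname{rpc} X\le\alpha$. Consequently, if $\operatorname{rpc} B_X$ is an infinite regular cardinal, then $\operatorname{rpc} X=\operatorname{rpc} B_X$.
   Context: Let $M$ be a metric space; $U(x,r)$ denotes the open ball with centre $x$ and radius $r$. A covering of $M$ is a collection $\mathcal U$ of subsets of $M$ with $\bigcup\mathcal U=M$. A covering $\mathcal V$ is a refinement of a covering $\mathcal U$ if for every $V\in\mathcal V$ there is $U\in\mathcal U$ with $V\subset U$. A covering $\mathcal U$ of $M$ is uniform if there is $r>0$ such that the covering $\{U(x,r): x\in M\}$ is a refinement of $\mathcal U$. For a collection $\mathcal E$ of subsets of a set, its order $\operatorname{ord}\mathcal E$ is defined as follows: $\operatorname{ord}\mathcal E=n$ if $n=\max\{\operatorname{card}\mathcal D:\mathcal D\subset\mathcal E,\ \bigcap\mathcal D\ne\emptyset\}$ exists and is a natural number; otherwise $\operatorname{ord}\mathcal E$ is the infinite cardinal $\sup\{(\operatorname{card}\mathcal D)^+:\mathcal D\subset\mathcal E,\ \bigcap\mathcal D\neq\emptyset\}$, where $\kappa^+$ denotes the successor cardinal of $\kappa$. The reduced point character $\operatorname{rpc} M$ is the least cardinal $\alpha$ such that every uniform covering of $M$ has a uniform refinement $\mathcal V$ with $\operatorname{ord}\mathcal V\le\alpha$. *)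

(* Defs.v *)
From HB Require Import structures.
From mathcomp Require Import all_boot all_order all_algebra.
From mathcomp Require Import all_classical all_reals all_analysis.
Set Implicit Arguments.
Unset Strict Implicit.
Unset Printing Implicit Defensive.
Import Order.TTheory GRing.Theory Num.Theory.
Import numFieldNormedType.Exports.
Local Open Scope classical_set_scope.
Local Open Scope ring_scope.
Local Open Scope card_scope.

(** Cardinals are represented by types of one fixed universe, two types denoting
    the same cardinal when they are equipotent; the cardinal of a set is denoted
    by its subtype. *)
Definition cardinal : Type := Type.

Definition cardle (K L : cardinal) : Prop := [set: K] #<= [set: L].
Definition cardeq (K L : cardinal) : Prop := [set: K] #= [set: L].
Definition cardlt (K L : cardinal) : Prop := cardle K L /\ ~ cardle L K.

Definition is_least_card (P : cardinal -> Prop) (K : cardinal) : Prop :=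
  P K /\ forall L : cardinal, P L -> cardle K L.

(** Cardinals being well-ordered, there is a least one satisfying [P] as soon as
    one does (see [least_cardP]); [void] is a default value for empty [P]. *)
Definition least_card (P : cardinal -> Prop) : cardinal :=
  if pselect (exists K : cardinal, is_least_card P K) is left h
  then projT1 (cid h) else void.

Definition succ_card (K : cardinal) : cardinal := least_card (cardlt K).

Definition infinite_card (K : cardinal) : Prop := infinite_set [set: K].

(** [K] is not the union of fewer than [K] sets, each of cardinal less
    than [K]. *)
Definition regular_card (K : cardinal) : Prop :=
  forall F : set (set K),
    cardlt (set_type F) K ->
    (forall A : set K, F A -> cardlt (set_type A) K) ->
    \bigcup_(A in F) A <> [set: K].

Section Order_of_a_collection.
Variables (M : Type) (E : set (set M)).

(** For empty [D] the intersection is the whole of [M]. *)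
Definition has_common_point (D : set (set M)) : Prop :=
  D `<=` E /\ \bigcap_(A in D) A !=set0.

Definition is_max_card (n : nat) : Prop :=
  (exists2 D, has_common_point D & D #= `I_n) /\
  forall D, has_common_point D -> D #<= `I_n.

(** The supremum in the second case is the least upper bound. *)
Definition ord : cardinal :=
  if pselect (exists n, is_max_card n) is left h then 'I_(projT1 (cid h))
  else least_card (fun K => forall D, has_common_point D ->
                              cardle (succ_card (set_type D)) K).

End Order_of_a_collection.

Definition covering (M : Type) (U : set (set M)) : Prop :=
  \bigcup_(A in U) A = [set: M].

Definition refinement (M : Type) (V U : set (set M)) : Prop :=
  forall A, V A -> exists2 B, U B & A `<=` B.

(** The notions below only involve the open balls of a metric space. *)
Section Reduced_point_character.
Context {R : realType} (M : pseudoMetricType R).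

Definition uniform_covering (U : set (set M)) : Prop :=
  covering U /\
  exists2 r : R, 0 < r & refinement (range (fun x : M => ball x r)) U.

Definition rpc_bound (K : cardinal) : Prop :=
  forall U : set (set M), uniform_covering U ->
  exists V : set (set M),
    [/\ uniform_covering V, refinement V U & cardle (ord V) K].

Definition rpc : cardinal := least_card rpc_bound.

End Reduced_point_character.

(** As a type, it carries the structure of subspace of [X], whose open balls are
    the traces of those of [X] (see [ball_unit_ballE]). *)
Definition unit_ball (R : realType) (X : normedModType R) : set X :=
  [set x | `|x| <= 1].
Arguments unit_ball {R} X _.

Lemma ball_normedE (R : realType) (X : normedModType R) (x : X) (r : R) :
  ball x r = [set y | `|x - y| < r].
Proof. by rewrite -ball_normE. Qed.

Lemma ball_unit_ballE (R : realType) (X : normedModType R)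
    (x : set_type (unit_ball X)) (r : R) :
  ball x r = [set y | `|\val x - \val y| < r].
Proof.
by rewrite -[LHS]/(@set_val _ (unit_ball X) @^-1` ball (\val x) r) ball_normedE.
Qed.

(** Well-definedness of the least cardinals above. *)

Lemma cardleP (K L : cardinal) :
  cardle K L <-> exists f : K -> L, injective f.
Proof.
rewrite /cardle; split=> [/card_leP[f]|[f finj]].
  exists (fun x => val (f (SigSub (mem_set (I : [set: K] x))))) => x y /val_inj.
  by move=> /(@inj _ _ setT f); rewrite !in_setT => /(_ isT isT) [].
by rewrite -(card_le_eql (inj_card_eq (f := f) _)) ?card_leT//; exact: in2W.
Qed.

Lemma cardle_refl (K : cardinal) : cardle K K.
Proof. exact: card_lexx. Qed.

Lemma cardle_trans (K L N : cardinal) : cardle K L -> cardle L N -> cardle K N.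
Proof. exact: card_le_trans. Qed.

Lemma family_least_card (I : Type) (i0 : I) (F : I -> cardinal) :
  exists i, forall j, cardle (F i) (F j).
Proof.
pose P (S : set (forall i, F i)) :=
  forall f g i, S f -> S g -> f i = g i -> f = g.
have [|S [PS Smax]] := @Zorn_bigcup _ P.
  move=> C CP Ctot f g i [A CA Af] [B CB Bg].
  have [AB|BA] := Ctot _ _ CA CB.
    by apply: (CP _ CB) => //; exact: AB.
  by apply: (CP _ CA) => //; exact: BA.
have [[i Si]|nS] := pselect (exists i, forall x : F i, exists2 f, S f & f i = x).
  exists i => j; apply/cardleP.
  have /choice[h hP] : forall x : F i, exists f, S f /\ f i = x.
    by move=> x; have [f] := Si x; exists f.
  exists (fun x => h x j) => x y hxy.
  have hE : h x = h y by apply: PS hxy; [exact: (hP x).1|exact: (hP y).1].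
  by rewrite -(hP x).2 -(hP y).2 hE.
have /all_sig[f fP] : forall i, {x : F i | forall g, S g -> g i <> x}.
  move=> i; apply: cid; apply: contrapT => ni; apply: nS; exists i => x.
  apply: contrapT => nx; apply: ni; exists x => g Sg gx.
  by apply: nx; exists g.
exfalso; apply: (Smax (S `|` [set f])).
  split=> [|/(_ f (or_intror erefl)) Sf]; first exact: subsetUl.
  exact: fP i0 _ Sf erefl.
move=> g h i [Sg|->] [Sh|->] //; first exact: PS.
- by move=> /(fP i _ Sg).
- by move=> /esym/(fP i _ Sh).
Qed.

Lemma cardle_total (K L : cardinal) : cardle K L \/ cardle L K.
Proof.
have [[] bP] := @family_least_card bool true (fun b => if b then K else L).
- by left; exact: bP false.
- by right; exact: bP true.
Qed.

Lemma least_cardP (P : cardinal -> Prop) :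
  (exists K, P K) -> is_least_card P (least_card P).
Proof.
move=> [K PK].
suff ex : exists L, is_least_card P L.
  by rewrite /least_card; case: pselect => // h; exact: (projT2 (cid h)).
pose J := {A : set K | exists2 L, P L & cardle L (set_type A) /\
                                        cardle (set_type A) L}.
have KJ : exists2 L, P L & cardle L (set_type [set: K]) /\
                           cardle (set_type [set: K]) L.
  exists K => //; rewrite /cardle; split; apply/cardleP.
    by exists (fun x => SigSub (mem_set (I : [set: K] x))) => x y [].
  by exists val; exact: val_inj.
have [[A /= [L PL [LA AL]]] Amin] :=
  @family_least_card J (exist _ _ KJ) (fun A => set_type (projT1 A)).
exists L; split=> // N PN; apply: cardle_trans LA _.
have [KN|/cardleP[f finj]] := cardle_total K N.
  apply: cardle_trans KN; apply/cardleP; exists val; exact: val_inj.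
have NJ : exists2 L, P L & cardle L (set_type (range f)) /\
                           cardle (set_type (range f)) L.
  exists N => //; split.
    apply/cardleP; exists (fun x => SigSub (mem_set (imageT f x))).
    by move=> x y [/finj].
  rewrite /cardle (card_le_eql (card_setT (range f))); exact: card_image_le.
apply: cardle_trans (Amin (exist _ _ NJ)) _ => /=.
rewrite /cardle (card_le_eql (card_setT (range f))); exact: card_image_le.
Qed.

Lemma cardlt_set (K : cardinal) : cardlt K (set K).
Proof.
split.
  apply/cardleP; exists (@set1 K) => x y xy.
  by have : [set y] x by rewrite -xy.
move=> /cardleP[g ginj].
pose D := [set x | exists2 A, g A = x & ~ A x].
have nD : ~ D (g D).
  by move=> DD; case: (DD) => A /ginj ->; exact.
by apply: (nD); exists D.
Qed.

Lemma succ_cardP (K : cardinal) : is_least_card (cardlt K) (succ_card K).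
Proof. by apply: least_cardP; exists (set K); exact: cardlt_set. Qed.

Lemma ord_finite (M : Type) (E : set (set M)) (n : nat) :
  is_max_card E n -> ord E = 'I_n.
Proof.
move=> En; rewrite /ord; case: pselect => [h|[]]; last by exists n.
case: cid => m /= Em; congr 'I_(_).
apply/eqP; rewrite eqn_leq -!card_le_II; apply/andP; split.
- by have [[D ED /card_eqPle[_ mD]] _] := Em; exact: card_le_trans mD (En.2 _ ED).
- by have [[D ED /card_eqPle[_ nD]] _] := En; exact: card_le_trans nD (Em.2 _ ED).
Qed.

Lemma subtype_cardle (T : cardinal) (D : set T) : cardle (set_type D) T.
Proof. by apply/cardleP; exists val; exact: val_inj. Qed.

Lemma ord_infinite (M : cardinal) (E : set (set M)) :
  ~ (exists n, is_max_card E n) ->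
  is_least_card (fun K => forall D, has_common_point E D ->
                            cardle (succ_card (set_type D)) K) (ord E).
Proof.
move=> nE; rewrite /ord; case: pselect => // _.
apply: least_cardP; exists (set (set M)) => D ED.
apply: (succ_cardP _).2; have [MS nSM] := cardlt_set (set M).
have DM := subtype_cardle D.
split; first exact: cardle_trans DM MS.
by move=> SD; apply: nSM; exact: cardle_trans SD DM.
Qed.

Lemma ord_bound (M : cardinal) (E : set (set M)) :
  cardle (ord E) (set (set M)).
Proof.
have [MS nSM] := cardlt_set (set M).
have [[n En]|nE] := pselect (exists n, is_max_card E n).
  rewrite (ord_finite En); have [[D ED /card_eqPle[_ nD]] _] := En.
  apply: cardle_trans MS; apply: cardle_trans (subtype_cardle D).
  rewrite /cardle (card_le_eqr (card_setT D)).
  apply: card_le_trans nD.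
  have : injective (fun i : 'I_n => i : nat) by exact: ord_inj.
  move=> iinj; rewrite -(card_le_eql (inj_card_eq (f := fun i : 'I_n => i : nat) _)).
    by apply: subset_card_le => _ [i _ <-] /=.
  by move=> i j _ _ /iinj.
apply: (ord_infinite nE).2 => D ED.
have DM := subtype_cardle D.
apply: (succ_cardP _).2; split; first exact: cardle_trans DM MS.
by move=> SD; apply: nSM; exact: cardle_trans SD DM.
Qed.

Lemma rpcP (R : realType) (M : pseudoMetricType R) :
  is_least_card (@rpc_bound R M) (rpc M).
Proof.
apply: least_cardP; exists (set (set M)) => U Uu; exists U; split => //.
- by move=> A UA; exists A.
- exact: ord_bound.
Qed.

(* Main.v *)
Require Import Defs.
From mathcomp Require Import all_boot all_order all_algebra.
From mathcomp Require Import all_classical all_reals all_analysis.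
From mathcomp Require Import lra.

(** Scaling and translating a uniform covering of the unit ball by sets of radius
    1/2 with Lebesgue number d gives, for every ball of radius t, a covering by
    sets of radius t/2 with Lebesgue number td. Covering a ball of radius 2^n t by
    sets of radius 2^n t/2, each of these by sets of radius 2^n t/4, and so on,
    one reaches radius t/2 with Lebesgue number td, independent of n: only the
    last step counts. After finitely many steps a point is still in fewer than
    alpha sets, alpha being regular. These coverings of larger and larger balls
    are glued into one of X by cutting out of the n-th one a ball of radius
    proportional to n, so that a point meets only finitely many of them.
    Conversely, coverings of X restrict to the unit ball. *)

Set Implicit Arguments.
Unset Strict Implicit.
Unset Printing Implicit Defensive.
Import Order.TTheory GRing.Theory Num.Theory.
Import numFieldNormedType.Exports.
Local Open Scope classical_set_scope.
Local Open Scope ring_scope.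
Local Open Scope card_scope.

(** * Sets of fewer than [K] elements *)

Lemma cardltE (K L : cardinal) : cardlt K L <-> ~ cardle L K.
Proof.
split=> [[]//|LK]; split=> //.
by have [] := cardle_total K L.
Qed.

Lemma cardle_set_type (K T : cardinal) (A : set T) :
  cardle K (set_type A) <-> [set: K] #<= A.
Proof. by rewrite /cardle (card_le_eqr (card_setT A)). Qed.

Lemma card_ordT (n : nat) : [set: 'I_n] #= `I_n.
Proof.
have ninj : {in [set: 'I_n] &, injective (@nat_of_ord n)}.
  by move=> i j _ _; exact: val_inj.
have <- : @nat_of_ord n @` [set: 'I_n] = `I_n.
  by apply/seteqP; split=> [_ [i _ <-]//=|i /= ni]; exists (Ordinal ni).
by rewrite card_eq_sym; exact: inj_card_eq.
Qed.

(** By comparability of cardinals this says that [A] has fewer than [K] elements; the negative form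
    makes monotonicity immediate. *)
Definition small (K T : cardinal) (A : set T) : Prop := ~ ([set: K] #<= A).

Lemma smallE (K T : cardinal) (A : set T) :
  cardlt (set_type A) K <-> small K A.
Proof. by rewrite cardltE cardle_set_type. Qed.

Lemma small_card_le (K T U : cardinal) (A : set T) (B : set U) :
  B #<= A -> small K A -> small K B.
Proof. by move=> BA KA KB; apply: KA; exact: card_le_trans KB BA. Qed.

Lemma small_subset (K T : cardinal) (A B : set T) :
  B `<=` A -> small K A -> small K B.
Proof. by move=> /subset_card_le; exact: small_card_le. Qed.

Lemma small_image (K T U : cardinal) (f : T -> U) (A : set T) :
  small K A -> small K (f @` A).
Proof. exact/small_card_le/card_image_le. Qed.

Lemma finite_small (K T : cardinal) (A : set T) :
  infinite_card K -> finite_set A -> small K A.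
Proof. by move=> Kinf Afin KA; apply: Kinf; exact: card_le_finite KA Afin. Qed.

(** An embedding of [K] into the union would pull the sets [G i] back to fewer than [K] small sets
    with union [K], against regularity. *)
Lemma small_bigcup (K T I : cardinal) (F : set I) (G : I -> set T) :
  regular_card K -> small K F -> (forall i, F i -> small K (G i)) ->
  small K (\bigcup_(i in F) G i).
Proof.
move=> Kreg KF KG /cardle_set_type/cardleP[f finj].
pose P i := [set k | G i (val (f k))].
apply: (Kreg (P @` F)); first by apply/smallE; exact: small_image.
  move=> _ [i Fi <-]; apply/smallE; apply: small_card_le (KG i Fi).
  have vfinj : injective (val \o f) by move=> x y /val_inj /finj.
  rewrite -(card_le_eql (inj_card_eq (A := P i) (f := val \o f) _)); last exact: in2W.
  by apply: subset_card_le => _ [k Pk <-].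
rewrite -subTset => k _; have := valP (f k).
by rewrite in_setE => -[i Fi Gi]; exists (P i) => //; exists i.
Qed.

(** * The order of a collection *)

Lemma ord_le_of_lt (M : cardinal) (E : set (set M)) (K : cardinal) :
  (forall D, has_common_point E D -> cardlt (set_type D) K) ->
  cardle (ord E) K.
Proof.
move=> EK; have [[n En]|nE] := pselect (exists n, is_max_card E n).
  rewrite (ord_finite En); have [[D ED Dn] _] := En.
  apply: cardle_trans (EK _ ED).1; apply/cardle_set_type.
  rewrite (card_le_eql (card_ordT n)).
  by move: Dn => /card_eqPle[].
by apply: (ord_infinite nE).2 => D /EK; exact: (succ_cardP _).2.
Qed.

Lemma ord_le_of_le (M : Type) (E : set (set M)) (n : nat) :
  (forall D, has_common_point E D -> D #<= `I_n) -> cardle (ord E) 'I_n.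
Proof.
move=> En; have [nE|Elt] := pselect (is_max_card E n).
  by rewrite (ord_finite nE); exact: cardle_refl.
(* If some [D] had at least [n] elements, the maximum [n] would be attained. *)
apply: ord_le_of_lt => D ED; apply/smallE => nD; apply: Elt.
split=> //; exists D => //; apply/card_eqPle; split; first exact: En.
by rewrite -(card_le_eql (card_ordT n)).
Qed.

Lemma lt_of_ord_infinite (M : cardinal) (E D : set (set M)) :
  ~ (exists n, is_max_card E n) -> has_common_point E D ->
  cardlt (set_type D) (ord E).
Proof.
move=> nE ED; apply/cardltE => oD.
have [[_ nDS] _] := succ_cardP (set_type D); apply: nDS.
by apply: cardle_trans oD; exact: (ord_infinite nE).1.
Qed.

(** An infinite order is a supremum of successors, so bounding it by [K] bounds each cardinal
    strictly by [K]; a finite order gives finite families, small since [K] is infinite. *)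
Lemma ord_leP (M : cardinal) (E : set (set M)) (K : cardinal) :
  infinite_card K ->
  cardle (ord E) K <-> forall x, small K [set A | E A /\ A x].
Proof.
move=> Kinf; split=> [EK x|KE].
  have Ex : has_common_point E [set A | E A /\ A x].
    by split=> [A []//|]; exists x => A [].
  have [[n En]|nE] := pselect (exists n, is_max_card E n).
    apply: finite_small => //; apply: card_le_finite (En.2 _ Ex) _.
    exact: finite_II.
  apply/smallE/cardltE => KD.
  have /cardltE := lt_of_ord_infinite nE Ex; apply.
  exact: cardle_trans EK KD.
apply: ord_le_of_lt => D [DE [x Dx]]; apply/smallE.
by apply: small_subset (KE x) => A DA; split; [exact: DE|exact: Dx].
Qed.

Lemma ord_le_ord (M N : cardinal) (E : set (set M)) (F : set (set N)) :
  (forall D, has_common_point F D ->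
     exists2 D', has_common_point E D' & D #<= D') ->
  cardle (ord F) (ord E).
Proof.
move=> FE; have [[n En]|nE] := pselect (exists n, is_max_card E n).
  rewrite (ord_finite En); apply: ord_le_of_le => D /FE[D' ED' DD'].
  exact: card_le_trans DD' (En.2 _ ED').
apply: ord_le_of_lt => D /FE[D' ED' DD']; apply/smallE.
by apply: small_card_le DD' _; apply/smallE; exact: lt_of_ord_infinite.
Qed.

Lemma ord_preimage (M N : cardinal) (f : N -> M) (E : set (set M)) :
  cardle (ord (preimage f @` E)) (ord E).
Proof.
apply: ord_le_ord => D [DE [x Dx]].
exists [set A | E A /\ D (f @^-1` A)].
  split=> [A []//|]; exists (f x) => A [_]; exact: Dx.
apply: card_le_trans (card_image_le (preimage f) _).
apply: subset_card_le => B DB; have [A EA AB] := DE _ DB.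
by exists A => //; split=> //; rewrite AB.
Qed.

(** * Uniform coverings and their traces on the unit ball *)

Lemma uniform_covering_balls (R : realType) (M : pseudoMetricType R) (r : R) :
  0 < r -> uniform_covering (range (fun x : M => ball x r)).
Proof.
move=> r0; split; last by exists r => // A Ar; exists A.
rewrite /covering -subTset => x _; exists (ball x r); first by exists x.
exact: ballxx.
Qed.

Lemma uniform_coveringP (R : realType) (M : pseudoMetricType R)
    (V : set (set M)) (r : R) :
  0 < r -> (forall x, exists2 A, V A & ball x r `<=` A) -> uniform_covering V.
Proof.
move=> r0 Vr; split; last by exists r => // _ [x _ <-].
rewrite /covering -subTset => x _; have [A VA rA] := Vr x.
by exists A => //; apply: rA; exact: ballxx.
Qed.

Lemma rpc_boundP (R : realType) (M : pseudoMetricType R) (K : cardinal) :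
  cardle (rpc M) K <-> rpc_bound M K.
Proof.
split=> [MK U /(rpcP M).1[V [Vu VU VM]]|]; last exact: (rpcP M).2.
by exists V; split=> //; exact: cardle_trans MK.
Qed.

Section Normed_space.
Context {R : realType} (X : normedModType R).

Lemma rpc_unit_ball_le : cardle (rpc (unit_ball X)) (rpc X).
Proof.
apply/rpc_boundP => U [_ [r r0 rU]].
(* The centre of a ball containing [A] may lie outside the unit ball; halving the radius allows
   recentring at a point of [A] inside it. *)
have r20 : 0 < r / 2 by rewrite divr_gt0.
have [V [[_ [s s0 sV]] VU ordV]] := (rpcP X).1 _ (uniform_covering_balls X r20).
pose f := @set_val _ (unit_ball X).
exists (preimage f @` V); split.
- apply: (uniform_coveringP s0) => x.
  have [|A VA sA] := sV (ball (f x) s); first by exists (f x).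
  by exists (f @^-1` A); [exists A|move=> y /sA].
- have rU' x : exists2 B, U B & ball x r `<=` B by apply: rU; exists x.
  move=> _ [A VA <-]; have [_ [c _ <-] Ac] := VU _ VA.
  have [[x Ax]|/forallNP nA] := pselect (exists x, A (f x)).
    have [B UB rB] := rU' x; exists B => // y Ay; apply: rB.
    exact: ball_splitr (Ac _ Ax) (Ac _ Ay).
  (* Here the trace of [A] is empty and any member of [U] will do; the point 0 provides one. *)
  have u0 : unit_ball X 0 by rewrite /unit_ball /= normr0.
  have [B UB _] := rU' (SigSub (mem_set u0)).
  by exists B => // y /nA.
- exact: cardle_trans (ord_preimage _ _) ordV.
Qed.

(** * Fine coverings of balls *)

Local Notation cball c r := (closed_ball_ (@Num.norm R X) c r).

Variable K : cardinal.
Hypothesis Kinf : infinite_card K.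
Hypothesis Kreg : regular_card K.

(* The order condition is [ord V <= K], see [ord_leP]; [d] is a Lebesgue number
   of the covering [V] of [S] by sets of radius [e]. *)
Definition fine_cover (S : set X) (e d : R) (V : set (set X)) : Prop :=
  [/\ forall A, V A -> exists c, A `<=` ball c e,
      forall x, S x -> exists2 A, V A & S `&` ball x d `<=` A
    & forall x, small K [set A | V A /\ A x]].

Lemma fine_cover_affine (e d t : R) (c : X) (V : set (set X)) : 0 < t ->
  fine_cover (cball 0 1) e d V ->
  exists W, fine_cover (cball c t) (t * e) (t * d) W.
Proof.
move=> t0 [Ve Vd VK]; pose g (y : X) := t^-1 *: (y - c).
have gE x y : `|g x - g y| = t^-1 * `|x - y|.
  rewrite -scalerBr normrZ gtr0_norm ?invr_gt0//.
  by rewrite opprB addrA subrK.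
exists (preimage g @` V); split.
- move=> _ [A VA <-]; have [b Ab] := Ve _ VA.
  have gb : g (c + t *: b) = b.
    by rewrite /g addrC addKr scalerA mulVf ?gt_eqF// scale1r.
  exists (c + t *: b) => y /Ab.
  by rewrite !ball_normedE /= -{1}gb gE ltr_pdivrMl.
- have gS y : cball c t y -> cball 0 1 (g y).
    rewrite /closed_ball_ /= sub0r normrN /g normrZ distrC gtr0_norm ?invr_gt0//.
    by rewrite ler_pdivrMl// mulr1.
  move=> x /gS /Vd[A VA dA]; exists (g @^-1` A); first by exists A.
  move=> y [/gS Sy]; rewrite ball_normedE /= => xy; apply: dA; split=> //.
  by rewrite ball_normedE /= gE ltr_pdivrMl.
- move=> x; apply: small_subset (small_image (f := preimage g) (VK (g x))).
  by move=> _ [[A VA <-] Ax]; exists A.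
Qed.

Lemma fine_cover_trans (S : set X) (e d e' d' : R) (V : set (set X)) :
    0 < d -> d' <= d -> fine_cover S e d V ->
    (forall c, exists W, fine_cover (cball c e) e' d' W) ->
  exists W, fine_cover S e' d' W.
Proof.
move=> d0 d'd [Ve Vd VK] /choice[W WP].
have /choice[c cP] : forall A, exists c, V A -> A `<=` ball c e.
  by move=> A; have [/Ve[c]|nA] := pselect (V A); [exists c|exists 0].
(* Cutting [B] down to [A] makes a point meet only those [W (c A)] with [A] containing it: fewer
   than [K] of them, so regularity applies. *)
exists (\bigcup_(A in V) ((fun B => A `&` B) @` W (c A))); split.
- move=> _ [A VA [B WB <-]]; have [We _ _] := WP (c A).
  by have [b Bb] := We _ WB; exists b => y [_ /Bb].
- move=> x Sx; have [A VA dA] := Vd x Sx; have [_ Wd _] := WP (c A).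
  have /(cP _ VA) : A x by apply: dA; split=> //; exact: ballxx.
  rewrite ball_normedE /= => /ltW /Wd[B WB dB].
  exists (A `&` B); first by exists A => //; exists B.
  move=> y [Sy xy]; have Ay : A y by apply: dA; split=> //; exact: le_ball xy.
  split=> //; apply: dB; split=> //.
  by have := cP _ VA _ Ay; rewrite ball_normedE => /ltW.
- move=> x; pose G A := (fun B => A `&` B) @` [set B | W (c A) B /\ B x].
  have KG : small K (\bigcup_(A in [set A | V A /\ A x]) G A).
    apply: small_bigcup => // A _; apply: small_image.
    by have [_ _] := WP (c A); exact.
  apply: small_subset KG => _ [[A VA [B WB <-]] [Ax Bx]].
  by exists A => //; exists B.
Qed.

(* Passing from radius [t] to [t / 2] costs only the last Lebesgue number, so
   that [t * d] does not depend on [n]. *)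
Lemma fine_cover_expn (d : R) (V : set (set X)) (n : nat) (t : R) :
    0 < d -> 0 < t -> fine_cover (cball 0 1) 2^-1 d V ->
  exists W, fine_cover (cball 0 (2 ^+ n * t)) (t * 2^-1) (t * d) W.
Proof.
move=> d0 t0 Vd; elim: n t t0 => [|n IHn] t t0.
  by rewrite expr0 mul1r; exact: fine_cover_affine Vd.
(* The large ball is unchanged, as [2 ^+ n * (2 * t)] equals [2 ^+ n.+1 * t]; the sets now have
   radius [t] and need one more halving. *)
have [|W] := IHn (2 * t); first by rewrite mulr_gt0.
rewrite mulrA -exprSr mulrAC divff ?mul1r// => Wd.
apply: fine_cover_trans Wd _; first by rewrite !mulr_gt0.
  by rewrite ler_pM2r//; lra.
by move=> c; exact: fine_cover_affine Vd.
Qed.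

Lemma fine_cover_unit_ball : rpc_bound (unit_ball X) K ->
  exists V, exists2 d, 0 < d & fine_cover (cball 0 1) 2^-1 d V.
Proof.
have h0 : 0 < 2^-1 :> R by rewrite invr_gt0.
move=> /(_ _ (uniform_covering_balls _ h0))[V [[_ [d d0 dV]] Ve]].
move=> /(ord_leP _ Kinf) VK.
pose f := @set_val _ (unit_ball X).
exists (image^~ f @` V), d => //; split.
- move=> _ [A /Ve[_ [c _ <-] Ac] <-]; exists (f c).
  by move=> _ [y /Ac ? <-].
- have uP y : cball 0 1 y -> exists x, f x = y.
    rewrite /closed_ball_ /= sub0r normrN => y1.
    by exists (SigSub (mem_set (y1 : unit_ball X y))).
  move=> _ /uP[x <-]; have [|A VA dA] := dV (ball x d); first by exists x.
  exists (f @` A); first by exists A.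
  by move=> _ [/uP[y <-] xy]; exists y => //; exact: dA.
- move=> y; have [[x xy]|ny] := pselect (exists x, f x = y).
    apply: small_subset (small_image (f := image^~ f) (VK x)).
    move=> _ [[A VA <-] [z Az zy]]; exists A => //; split=> //.
    by rewrite (_ : x = z)//; apply: val_inj; rewrite [LHS]xy.
  apply: finite_small => //; apply: (sub_finite_set (B := set0)) => //.
  by move=> _ [[A _ <-] [z _ zy]]; apply: ny; exists z.
Qed.

(** * Gluing into a covering of the whole space *)

Lemma rpc_bound_of_unit_ball : rpc_bound (unit_ball X) K -> rpc_bound X K.
Proof.
move=> /fine_cover_unit_ball[V [d d0 Vd]] U [_ [r r0 rU]].
(* With [t = 2 * r], sets of radius [t / 2] fit into balls of radius [r]. *)
have t0 : 0 < 2 * r by rewrite mulr_gt0.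
have /choice[W WP] n := fine_cover_expn n.+1 d0 t0 Vd.
(* Each point lies in [far n] for finitely many [n] only, whereas [ball x r] is
   contained in [far n] as soon as [n * (2 * r) <= |x|]. *)
pose far n := [set y : X | (n%:R - 1) * (2 * r) < `|y|].
pose Y := \bigcup_n ((fun A => A `&` far n) @` W n).
exists Y; split.
- have s0 : 0 < Num.min r (2 * r * d) by rewrite lt_min r0 mulr_gt0.
  apply: (uniform_coveringP s0) => x.
  have [n /andP[nx xn]] : exists n, n%:R * (2 * r) <= `|x| < n.+1%:R * (2 * r).
    exists (Num.truncn (`|x| / (2 * r))).
    by rewrite -ler_pdivlMr// -ltr_pdivrMr// truncn_itv// divr_ge0// ltW.
  have [_ Wd _] := WP n.
  (* Points near [x] may have norm up to [n.+2%:R * (2 * r)]; the exponent [n.+1] suffices because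
     [n.+2 <= 2 ^ n.+1]. *)
  have Sy (y : X) : `|y| < n.+2%:R * (2 * r) -> cball 0 (2 ^+ n.+1 * (2 * r)) y.
    move=> yn; rewrite /closed_ball_ /= sub0r normrN (le_trans (ltW yn))//.
    by rewrite ler_pM2r// -natrX ler_nat ltn_expl.
  have [|A WA dA] := Wd x.
    by apply: Sy; apply: lt_le_trans xn _; rewrite ler_pM2r// ler_nat.
  exists (A `&` far n); first by exists n => //; exists A.
  move=> y; rewrite ball_normedE /= lt_min => /andP[xyr xyd].
  have yx := lerB_dist y x; have xy := lerB_dist x y.
  rewrite distrC in yx.
  split; last by rewrite /far /=; nra.
  apply: dA; split; last by rewrite ball_normedE.
  apply: Sy; move: xn; rewrite -!natr1; nra.
- move=> _ [n _ [A WA <-]]; have [We _ _] := WP n.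
  have [c Ac] := We _ WA; have [|B UB rB] := rU (ball c r); first by exists c.
  exists B => // y [/Ac yc _]; apply: rB; apply: le_ball yc.
  by rewrite mulrAC divff// mul1r.
- apply/(ord_leP _ Kinf) => x.
  pose G n := (fun A => A `&` far n) @` [set A | W n A /\ A x].
  have KG : small K (\bigcup_(n in [set n | far n x]) G n).
    apply: small_bigcup => //; last first.
      by move=> n _; apply: small_image; have [_ _] := WP n; exact.
    (* If [x] lies in [far n], then [n - 1 < |x| / (2 * r)], so [n] is below the truncation plus
       2. *)
    apply: finite_small => //.
    apply: (sub_finite_set (B := `I_(Num.truncn (`|x| / (2 * r))).+2)); last first.
      exact: finite_II.
    move=> n; rewrite /far /= -ltr_pdivlMr// => nx.
    have := truncnS_gt (`|x| / (2 * r)).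
    by move=> /(lt_trans nx); rewrite ltrBlDr natr1 ltr_nat.
  apply: small_subset KG => _ [[n _ [A WA <-]] [Ax nx]].
  by exists n => //; exists A.
Qed.

End Normed_space.

Theorem theorem13 (R : realType) (X : normedModType R) :
  (forall alpha : cardinal,
     infinite_card alpha -> regular_card alpha ->
     cardle (rpc (unit_ball X)) alpha -> cardle (rpc X) alpha) /\
  (infinite_card (rpc (unit_ball X)) -> regular_card (rpc (unit_ball X)) ->
     cardeq (rpc X) (rpc (unit_ball X))).
Proof.
have main alpha : infinite_card alpha -> regular_card alpha ->
    cardle (rpc (unit_ball X)) alpha -> cardle (rpc X) alpha.
  move=> ainf areg /rpc_boundP Ba; apply/rpc_boundP.
  exact: rpc_bound_of_unit_ball.
split=> // Binf Breg; apply/card_eqPle; split.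
- by apply: main => //; exact: cardle_refl.
- exact: rpc_unit_ball_le.
Qed.
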